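(* Let $-1 < D < C \leq 1$. If either of the following two conditions holds: (i) $(1-\sinh^{-1}(1))(1-D^2) < 1-CD\leq 1-D^2$ and $C-D\leq (1-D)\sinh^{-1}(1)$; (ii) $1-D^2 \leq 1-CD < (1+\sinh^{-1}(1))(1-D^2)$ and $C-D\leq (1+D)\sinh^{-1}(1)$; then $\mathcal{S}^{*}[C,D]\subset \mathcal{S}^*_{\rho}$.
   Context: $\mathbb{D}=\{z\in\mathbb{C}:|z|<1\}$. $\mathcal{A}$ is the class of analytic functions $f$ on $\mathbb{D}$ with $f(z)=z+a_2z^2+a_3z^3+\cdots$; $\mathcal{S}\subset\mathcal{A}$ is the subclass of univalent functions. For analytic $g,h$ on $\mathbb{D}$, $g\prec h$ (subordination) means $g=h\circ\omega$ for some analytic $\omega$ on $\mathbb{D}$ with $\omega(0)=0$ and $|\omega(z)|\le|z|$. $\sinh^{-1}(z)=\ln(z+\sqrt{1+z^2})$ is the principal branch (analytic in $\mathbb{D}$, $\sinh^{-1}(0)=0$). $\mathcal{S}^*_{\rho}=\{f\in\mathcal{A}: zf'(z)/f(z)\prec 1+\sinh^{-1}(z)\}$. For $-1\le D<C\le1$, the class of Janowski starlike functions is $\mathcal{S}^*[C,D]=\{f\in\mathcal{S}: zf'(z)/f(z)\prec (1+Cz)/(1+Dz)\}$. *)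

(* Defs.v *)
From Stdlib Require Import Reals Lra.
From Coquelicot Require Import Coquelicot.

Open Scope R_scope.

Definition unit_disk (z : C) : Prop := Cmod z < 1.

(* Analytic on the open unit disk: complex differentiable at each of its points.
   Functions are total on C, but only their values on the disk matter. *)
Definition analytic_on_disk (f : C -> C) : Prop :=
  forall z : C, unit_disk z -> @ex_derive C_AbsRing C_NormedModule f z.

(* f(z) = z + a_2 z^2 + a_3 z^3 + ... on the disk. *)
Definition class_A (f : C -> C) : Prop :=
  analytic_on_disk f /\
  exists a : nat -> C,
    a 0%nat = RtoC 0 /\ a 1%nat = RtoC 1 /\
    forall z : C, unit_disk z -> @is_pseries C_AbsRing C_NormedModule a z (f z).

Definition univalent (f : C -> C) : Prop :=
  forall z1 z2 : C, unit_disk z1 -> unit_disk z2 -> f z1 = f z2 -> z1 = z2.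

Definition class_S (f : C -> C) : Prop := class_A f /\ univalent f.

Definition subordinate (g h : C -> C) : Prop :=
  analytic_on_disk g /\ analytic_on_disk h /\
  exists w : C -> C,
    analytic_on_disk w /\
    w (RtoC 0) = RtoC 0 /\
    (forall z : C, unit_disk z -> Cmod (w z) <= Cmod z) /\
    (forall z : C, unit_disk z -> g z = h (w z)).

(* Principal argument, with values in (-PI, PI] (and 0 at the origin). *)
Definition Carg (z : C) : R :=
  let x := Re z in
  let y := Im z in
  if Rlt_dec 0 x then atan (y / x)
  else if Rlt_dec x 0 then
    if Rle_dec 0 y then atan (y / x) + PI else atan (y / x) - PI
  else if Rlt_dec 0 y then PI / 2
  else if Rlt_dec y 0 then - (PI / 2)
  else 0.

(* Principal branches of the logarithm and of the square root. *)
Definition Clog (z : C) : C := (ln (Cmod z), Carg z).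

Definition Csqrt (z : C) : C :=
  (sqrt (Cmod z) * cos (Carg z / 2), sqrt (Cmod z) * sin (Carg z / 2)).

Definition Carcsinh (z : C) : C := Clog (z + Csqrt (1 + z * z))%C.

(* On the real axis this is the standard library's real function, so that
   sinh^{-1}(1) may be written [arcsinh 1]. *)
Lemma Carcsinh_RtoC (x : R) : Carcsinh (RtoC x) = RtoC (arcsinh x).
Proof.
  assert (Harg : forall t : R, 0 < t -> Carg (RtoC t) = 0).
  { intros t Ht. unfold Carg; simpl.
    destruct (Rlt_dec 0 t) as [_ | n]; [ | contradiction ].
    unfold Rdiv; rewrite Rmult_0_l; apply atan_0. }
  assert (Hpos : 0 < 1 + x * x) by nra.
  assert (Hsq : Csqrt (1 + RtoC x * RtoC x)%C = RtoC (sqrt (x ^ 2 + 1))).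
  { replace (1 + RtoC x * RtoC x)%C with (RtoC (1 + x * x))
      by (now rewrite RtoC_plus, RtoC_mult).
    unfold Csqrt; rewrite Harg, Cmod_R, Rabs_pos_eq by lra.
    replace (0 / 2) with 0 by lra; rewrite cos_0, sin_0, Rmult_1_r, Rmult_0_r.
    now replace (1 + x * x) with (x ^ 2 + 1) by ring. }
  unfold Carcsinh; rewrite Hsq, <- RtoC_plus.
  assert (H : 0 < x + sqrt (x ^ 2 + 1)).
  { assert (Hs : sqrt (x ^ 2) < sqrt (x ^ 2 + 1))
      by (apply sqrt_lt_1; nra).
    replace (x ^ 2) with (Rsqr x) in Hs at 1 by (unfold Rsqr; ring).
    rewrite sqrt_Rsqr_abs in Hs.
    pose proof (Rle_abs (- x)) as Hx; rewrite Rabs_Ropp in Hx; lra. }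
  unfold Clog; rewrite Harg, Cmod_R, Rabs_pos_eq by lra.
  reflexivity.
Qed.

(* z f'(z) / f(z), with its removable singularity at 0 filled in: for f in
   class_A the quotient tends to 1 at the origin. *)
Definition star_quotient (f : C -> C) (z : C) : C :=
  if Ceq_dec z (RtoC 0) then RtoC 1 else (z * C_derive f z / f z)%C.

(* The first clause says that the quotient is genuinely defined on the disk
   (division by 0 is total here); it is automatic for univalent f. *)
Definition star_subordinate (f h : C -> C) : Prop :=
  (forall z : C, unit_disk z -> z <> RtoC 0 -> f z <> RtoC 0) /\
  subordinate (star_quotient f) h.

Definition S_star_rho (f : C -> C) : Prop :=
  class_A f /\ star_subordinate f (fun z : C => (1 + Carcsinh z)%C).

Definition S_star_Janowski (c d : R) (f : C -> C) : Prop :=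
  class_S f /\
  star_subordinate f (fun z : C => ((1 + RtoC c * z) / (1 + RtoC d * z))%C).

(* Main.v *)
Require Import Defs.
From Stdlib Require Import Reals Lra.
From Coquelicot Require Import Coquelicot.

(** In case (i) [d >= 0] and in case (ii) [d <= 0], so both say that
    [c - d <= (1 - |d|) s] with [s = arcsinh 1].  If [q = z f' / f] is the
    Janowski function at [w z] with [|w z| <= |z| < 1], then
    [|q z - 1| <= (c - d) |w z| / (1 - |d| |w z|) <= s |z|].  Since
    [|sinh u| <= sinh |u|] and [sinh] is convex on the nonnegative axis,
    [omega = sinh (q - 1)] satisfies [|omega z| <= |z| sinh s = |z|], which
    replaces Schwarz's lemma, and [q = 1 + arcsinh omega] because
    [|q z - 1| < pi / 2]. *)

Open Scope R_scope.

(** * Complex differentiability and the Cauchy-Riemann criterion *)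

(** Bridges the two normed-module structures on [C]: the chain, identity and product rules speak of
    [C] as a module over itself. The error estimates coincide, so only linearity of the differential
    is proved anew. *)
Lemma is_derive_C_AbsRing (f : C -> C) (z l : C) :
  @is_derive C_AbsRing C_NormedModule f z l <->
  @is_derive C_AbsRing (AbsRing_NormedModule C_AbsRing) f z l.
Proof.
  split; intros [_ H]; (split; [apply is_linear_scal_l | exact H]).
Qed.

Lemma is_C_derive_comp (f g : C -> C) (z l m : C) :
  @is_derive C_AbsRing C_NormedModule f (g z) l ->
  @is_derive C_AbsRing C_NormedModule g z m ->
  @is_derive C_AbsRing C_NormedModule (fun t => f (g t)) z (m * l)%C.
Proof.
  intros Hf Hg.
  exact (is_derive_comp f g z l m Hf (proj1 (is_derive_C_AbsRing _ _ _) Hg)).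
Qed.

Lemma Cmod_le_Rabs_sum (z : C) : Cmod z <= Rabs (fst z) + Rabs (snd z).
Proof.
  destruct z as [x y]; unfold Cmod; simpl.
  pose proof (Rabs_pos x); pose proof (Rabs_pos y).
  rewrite <- (sqrt_pow2 (Rabs x + Rabs y)) by lra.
  apply sqrt_le_1_alt.
  pose proof (pow2_abs x); pose proof (pow2_abs y); nra.
Qed.

(** Continuity of the partials in the first variable gives real differentiability of [u] and [v].
    The values [- vx] and [ux] of the other partials turn the real differential into multiplication
    by [ux + i vx]. *)
Lemma is_C_derive_Cauchy_Riemann (u v ux vx : R -> R -> R) (x y : R) :
  locally (x, y) (fun p : R * R =>
    is_derive (fun t : R => u t (snd p)) (fst p) (ux (fst p) (snd p))) ->
  locally (x, y) (fun p : R * R =>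
    is_derive (fun t : R => v t (snd p)) (fst p) (vx (fst p) (snd p))) ->
  is_derive (fun t : R => u x t) y (- vx x y) ->
  is_derive (fun t : R => v x t) y (ux x y) ->
  continuous (fun p : R * R => ux (fst p) (snd p)) (x, y) ->
  continuous (fun p : R * R => vx (fst p) (snd p)) (x, y) ->
  @is_derive C_AbsRing C_NormedModule
    (fun z : C => (u (fst z) (snd z), v (fst z) (snd z))) (x, y)
    (ux x y, vx x y).
Proof.
  intros Hu Hv Huy Hvy Cu Cv.
  destruct (is_derive_filterdiff u x y ux _ Hu Huy Cu) as [_ Du].
  destruct (is_derive_filterdiff v x y vx _ Hv Hvy Cv) as [_ Dv].
  specialize (Du (x, y) (fun P HP => HP)).
  specialize (Dv (x, y) (fun P HP => HP)).
  split; [apply is_linear_scal_l | ].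
  intros z Hz.
  (* The neighbourhood filter of [(x, y)] converges to no other point. *)
  apply (@is_filter_lim_locally_unique C_AbsRing (AbsRing_NormedModule C_AbsRing)) in Hz.
  rewrite <- Hz; clear z Hz.
  intros eps.
  (* Passes from neighbourhoods given by the modulus to those of the product [R * R]. Each real
     component then gets half of the error. *)
  apply locally_C.
  assert (He : 0 < eps / 2) by (destruct eps; simpl; lra).
  generalize (filter_and _ _ (Du (mkposreal _ He)) (Dv (mkposreal _ He))).
  apply filter_imp.
  intros [s t] [H1 H2].
  change (Rabs (u s t - u x y - ((s - x) * ux x y + (t - y) * - vx x y)) <=
    eps / 2 * sqrt (Rabs (s - x) ^ 2 + Rabs (t - y) ^ 2)) in H1.
  change (Rabs (v s t - v x y - ((s - x) * vx x y + (t - y) * ux x y)) <=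
    eps / 2 * sqrt (Rabs (s - x) ^ 2 + Rabs (t - y) ^ 2)) in H2.
  change (Cmod ((u s t, v s t) - (u x y, v x y)
                - ((s, t) - (x, y)) * (ux x y, vx x y)) <=
    eps * sqrt ((s - x) ^ 2 + (t - y) ^ 2)).
  rewrite 2!pow2_abs in H1, H2.
  eapply Rle_trans; [apply Cmod_le_Rabs_sum | simpl].
  replace (u s t + - u x y + - ((s + - x) * ux x y - (t + - y) * vx x y))
    with (u s t - u x y - ((s - x) * ux x y + (t - y) * - vx x y)) by ring.
  replace (v s t + - v x y + - ((s + - x) * vx x y + (t + - y) * ux x y))
    with (v s t - v x y - ((s - x) * vx x y + (t - y) * ux x y)) by ring.
  simpl in H1, H2; lra.
Qed.

(** * The complex exponential and hyperbolic functions *)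

Definition Cexp (z : C) : C := (exp (Re z) * cos (Im z), exp (Re z) * sin (Im z)).

(** The split into real and imaginary parts suits both the Cauchy-Riemann criterion and the estimate
    of the modulus by real functions. *)
Definition Csinh (z : C) : C := (sinh (Re z) * cos (Im z), cosh (Re z) * sin (Im z)).

Definition Ccosh (z : C) : C := (cosh (Re z) * cos (Im z), sinh (Re z) * sin (Im z)).

Lemma continuous_fst_comp (g : R -> R) (p : R * R) :
  continuity g -> continuous (fun q : R * R => g (fst q)) p.
Proof.
  intros Hg; apply (continuous_comp fst g); [apply continuous_fst | ].
  apply continuity_pt_filterlim, Hg.
Qed.

Lemma continuous_snd_comp (g : R -> R) (p : R * R) :
  continuity g -> continuous (fun q : R * R => g (snd q)) p.
Proof.
  intros Hg; apply (continuous_comp snd g); [apply continuous_snd | ].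
  apply continuity_pt_filterlim, Hg.
Qed.

Lemma is_derive_Cexp (z : C) : @is_derive C_AbsRing C_NormedModule Cexp z (Cexp z).
Proof.
  destruct z as [x y].
  apply (is_C_derive_Cauchy_Riemann
    (fun s t => exp s * cos t) (fun s t => exp s * sin t)
    (fun s t => exp s * cos t) (fun s t => exp s * sin t)).
  - apply filter_forall; intros [s t]; simpl; auto_derive; [exact I | ring].
  - apply filter_forall; intros [s t]; simpl; auto_derive; [exact I | ring].
  - auto_derive; [exact I | ring].
  - auto_derive; [exact I | ring].
  - apply (continuous_mult (fun p : R * R => exp (fst p)) (fun p => cos (snd p))).
    + apply continuous_fst_comp, derivable_continuous, derivable_exp.
    + apply continuous_snd_comp, continuity_cos.
  - apply (continuous_mult (fun p : R * R => exp (fst p)) (fun p => sin (snd p))).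
    + apply continuous_fst_comp, derivable_continuous, derivable_exp.
    + apply continuous_snd_comp, continuity_sin.
Qed.

Lemma is_derive_Csinh (z : C) : @is_derive C_AbsRing C_NormedModule Csinh z (Ccosh z).
Proof.
  destruct z as [x y].
  apply (is_C_derive_Cauchy_Riemann
    (fun s t => sinh s * cos t) (fun s t => cosh s * sin t)
    (fun s t => cosh s * cos t) (fun s t => sinh s * sin t)).
  - apply filter_forall; intros [s t]; simpl; auto_derive; [exact I | ring].
  - apply filter_forall; intros [s t]; simpl; auto_derive; [exact I | ring].
  - auto_derive; [exact I | ring].
  - auto_derive; [exact I | ring].
  - apply (continuous_mult (fun p : R * R => cosh (fst p)) (fun p => cos (snd p))).
    + apply continuous_fst_comp, derivable_continuous, derivable_cosh.
    + apply continuous_snd_comp, continuity_cos.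
  - apply (continuous_mult (fun p : R * R => sinh (fst p)) (fun p => sin (snd p))).
    + apply continuous_fst_comp, derivable_continuous, derivable_sinh.
    + apply continuous_snd_comp, continuity_sin.
Qed.

(** * The principal logarithm and square root on the right half-plane *)

Lemma locally_Re_pos (x y : R) :
  0 < x -> locally (x, y) (fun p : R * R => 0 < fst p).
Proof.
  intros Hx.
  apply (@continuous_fst R_UniformSpace R_UniformSpace x y (fun t => 0 < t)).
  exact (open_gt 0 x Hx).
Qed.

Lemma Clog_Re_pos (z : C) :
  0 < Re z -> Clog z = (ln (Cmod z), atan (Im z / Re z)).
Proof.
  intros Hz; unfold Clog, Carg.
  destruct (Rlt_dec 0 (Re z)); [reflexivity | contradiction].
Qed.

Lemma ln_sqrt_half (a : R) : 0 < a -> ln (sqrt a) = ln a / 2.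
Proof.
  intros Ha; pose proof (sqrt_lt_R0 a Ha).
  rewrite <- (sqrt_sqrt a) at 2 by lra.
  rewrite ln_mult by assumption; field.
Qed.

(** Near [z] the logarithm is [ln (x^2 + y^2) / 2 + i atan (y / x)], which satisfies the
    Cauchy-Riemann equations; [ux + i vx] is [1 / z]. *)
Lemma ex_derive_Clog (z : C) :
  0 < Re z -> @ex_derive C_AbsRing C_NormedModule Clog z.
Proof.
  destruct z as [x y]; intros Hx; simpl in Hx.
  set (ux := fun s t : R => s * / (s ^ 2 + t ^ 2)).
  set (vx := fun s t : R => - t * / (s ^ 2 + t ^ 2)).
  exists (ux x y, vx x y).
  assert (Hpos : forall s t, 0 < s -> 0 < s ^ 2 + t ^ 2) by (intros s t Hs; nra).
  apply (@is_derive_ext_loc C_AbsRing C_NormedModule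
    (fun z : C => (ln (fst z ^ 2 + snd z ^ 2) / 2, atan (snd z / fst z)) : C)).
  { apply locally_C; generalize (locally_Re_pos x y Hx); apply filter_imp.
    intros p Hp; rewrite Clog_Re_pos by exact Hp.
    unfold Cmod; rewrite ln_sqrt_half by now apply Hpos.
    reflexivity. }
  assert (Hinv : continuous (fun p : R * R => / (fst p ^ 2 + snd p ^ 2)) (x, y)).
  { apply (continuous_comp (fun p : R * R => fst p ^ 2 + snd p ^ 2) Rinv).
    - apply (@continuous_plus _ R_AbsRing R_NormedModule
        (fun p : R * R => fst p ^ 2) (fun p : R * R => snd p ^ 2)).
      + apply (continuous_fst_comp (fun t => t ^ 2)), derivable_continuous, derivable_pow.
      + apply (continuous_snd_comp (fun t => t ^ 2)), derivable_continuous, derivable_pow.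
    - apply continuous_Rinv; simpl fst; simpl snd; pose proof (Hpos x y Hx); lra. }
  apply (is_C_derive_Cauchy_Riemann
    (fun s t => ln (s ^ 2 + t ^ 2) / 2) (fun s t => atan (t / s)) ux vx).
  - generalize (locally_Re_pos x y Hx); apply filter_imp.
    intros [s t] Hs; cbn [fst snd] in *; unfold ux.
    pose proof (Hpos s t Hs).
    auto_derive; [lra | field; lra].
  - generalize (locally_Re_pos x y Hx); apply filter_imp.
    intros [s t] Hs; cbn [fst snd] in *; unfold vx.
    pose proof (Hpos s t Hs).
    auto_derive; [lra | field; lra].
  - pose proof (Hpos x y Hx); unfold vx.
    auto_derive; [lra | field; lra].
  - pose proof (Hpos x y Hx); unfold ux.
    auto_derive; [lra | field; lra].
  - apply (continuous_mult (fun p : R * R => fst p)); [apply continuous_fst | exact Hinv].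
  - apply (continuous_mult (fun p : R * R => - snd p)); [ | exact Hinv].
    apply (continuous_snd_comp Ropp), derivable_continuous, derivable_opp, derivable_id.
Qed.

Lemma Cexp_Clog (z : C) : 0 < Re z -> Cexp (Clog z) = z.
Proof.
  intros Hz; rewrite Clog_Re_pos by exact Hz.
  destruct z as [x y]; unfold Cexp; simpl in *.
  assert (Hxy : 0 < x ^ 2 + y ^ 2) by nra.
  (* The same root is the denominator of [cos (atan (y / x))] and [sin (atan (y / x))], so it
     cancels. *)
  assert (Hm : Cmod (x, y) = x * sqrt (1 + (y / x)²)).
  { unfold Cmod; simpl fst; simpl snd.
    replace (x ^ 2 + y ^ 2) with (x ^ 2 * (1 + (y / x)²))
      by (unfold Rsqr; field; lra).
    rewrite sqrt_mult_alt, sqrt_pow2 by nra; reflexivity. }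
  assert (Hs : 0 < sqrt (1 + (y / x)²))
    by (apply sqrt_lt_R0; pose proof (Rle_0_sqr (y / x)); lra).
  rewrite exp_ln by (rewrite Hm; nra).
  rewrite cos_atan, sin_atan, Hm.
  f_equal; field; lra.
Qed.

(** In this strip [cos (Im z) > 0], so [Cexp z] lies in the right half-plane, where the argument is
    an [atan] that inverts [tan]. *)
Lemma Clog_Cexp (z : C) : - (PI / 2) < Im z < PI / 2 -> Clog (Cexp z) = z.
Proof.
  intros Hz.
  assert (Hc : 0 < cos (Im z)) by (apply cos_gt_0; lra).
  pose proof (exp_pos (Re z)) as He.
  assert (Hr : 0 < Re (Cexp z)) by (simpl; nra).
  rewrite Clog_Re_pos by exact Hr.
  destruct z as [x y]; unfold Cexp; simpl in *.
  assert (Hm : Cmod (exp x * cos y, exp x * sin y) = exp x).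
  { unfold Cmod; simpl fst; simpl snd.
    replace ((exp x * cos y) ^ 2 + (exp x * sin y) ^ 2) with (exp x ^ 2).
    - apply sqrt_pow2; lra.
    - pose proof (sin2_cos2 y) as H; unfold Rsqr in H.
      replace (exp x ^ 2) with (exp x ^ 2 * (sin y * sin y + cos y * cos y))
        by (rewrite H; ring).
      ring. }
  rewrite Hm, ln_exp.
  replace (exp x * sin y / (exp x * cos y)) with (tan y)
    by (unfold tan; field; lra).
  now rewrite atan_tan by lra.
Qed.

Lemma Cexp_plus (z w : C) : Cexp (z + w) = (Cexp z * Cexp w)%C.
Proof.
  destruct z as [x y], w as [s t]; unfold Cexp, Cmult; simpl.
  rewrite exp_plus, cos_plus, sin_plus; f_equal; ring.
Qed.

(** Reduces the square and the derivative of the root to those of [Cexp] and [Clog]. *)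
Lemma Csqrt_Cexp (z : C) :
  0 < Re z -> Csqrt z = Cexp (Clog z / 2).
Proof.
  intros Hz.
  assert (Hm : 0 < Cmod z).
  { apply Cmod_gt_0; intros ->; simpl in Hz; lra. }
  replace (Clog z / 2)%C with (ln (Cmod z) / 2, Carg z / 2)
    by (unfold Clog, Cdiv, Cmult, Cinv; simpl; f_equal; field).
  unfold Csqrt, Cexp; simpl.
  replace (exp (ln (Cmod z) / 2)) with (sqrt (Cmod z)); [reflexivity | ].
  apply sqrt_lem_1; try lra.
  - apply Rlt_le, exp_pos.
  - rewrite <- exp_plus.
    replace (ln (Cmod z) / 2 + ln (Cmod z) / 2) with (ln (Cmod z)) by field.
    now apply exp_ln.
Qed.

Lemma Csqrt_sqr (z : C) : 0 < Re z -> (Csqrt z * Csqrt z = z)%C.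
Proof.
  intros Hz; rewrite Csqrt_Cexp, <- Cexp_plus by exact Hz.
  replace (Clog z / 2 + Clog z / 2)%C with (Clog z) 
    by (destruct (Clog z); unfold Cdiv, Cmult, Cinv, Cplus; simpl; f_equal; field).
  now apply Cexp_Clog.
Qed.

Lemma Re_Csqrt_pos (z : C) : 0 < Re z -> 0 < Re (Csqrt z).
Proof.
  intros Hz.
  assert (Hm : 0 < Cmod z).
  { apply Cmod_gt_0; intros ->; simpl in Hz; lra. }
  unfold Csqrt, Carg; simpl.
  destruct (Rlt_dec 0 (Re z)) as [_ | n]; [ | contradiction].
  apply Rmult_lt_0_compat; [now apply sqrt_lt_R0 | ].
  pose proof (atan_bound (Im z / Re z)); pose proof PI_RGT_0.
  apply cos_gt_0; lra.
Qed.

(** The product of [Csqrt z + w] and [Csqrt z - w] vanishes, and the first factor has positive real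
    part. *)
Lemma Csqrt_unique (z w : C) :
  0 < Re z -> 0 < Re w -> (w * w = z)%C -> Csqrt z = w.
Proof.
  intros Hz Hw Heq.
  pose proof (Csqrt_sqr z Hz) as Hs; pose proof (Re_Csqrt_pos z Hz) as Hp.
  destruct (Ceq_dec (Csqrt z + w)%C 0) as [H0 | H0].
  - apply (f_equal Re) in H0; simpl in *; unfold Re in *; lra.
  - assert (H : ((Csqrt z + w) * (Csqrt z - w) = 0)%C).
    { transitivity (Csqrt z * Csqrt z - w * w)%C; [ring | ].
      rewrite Hs, Heq; ring. }
    destruct (Ceq_dec (Csqrt z - w)%C 0) as [H1 | H1].
    + replace (Csqrt z) with (Csqrt z - w + w)%C by ring.
      rewrite H1; ring.
    + exfalso; exact (Cmult_neq_0 _ _ H0 H1 H).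
Qed.

Lemma ex_derive_Csqrt (z : C) :
  0 < Re z -> @ex_derive C_AbsRing C_NormedModule Csqrt z.
Proof.
  intros Hz.
  destruct (ex_derive_Clog z Hz) as [l Hl].
  exists (scal (l * / 2)%C (Cexp (Clog z / 2))).
  apply (is_derive_ext_loc (fun t => Cexp (Clog t / 2))).
  - apply locally_C; destruct z as [x y].
    generalize (locally_Re_pos x y Hz); apply filter_imp.
    intros p Hp; symmetry; apply Csqrt_Cexp, Hp.
  - apply (is_C_derive_comp Cexp (fun t => Clog t / 2)%C).
    + apply is_derive_Cexp.
    + apply (is_derive_ext (fun t => (Clog t * / 2)%C)); [reflexivity | ].
      apply (@is_derive_scal_l C_AbsRing C_NormedModule Clog z l (/ 2)%C).
      now apply is_derive_C_AbsRing.
Qed.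

(** * Analyticity of the inverse hyperbolic sine on the disk, and inversion of [Csinh] *)

(** Keeps the argument of the square root off the branch cut: the real part is [1 + x^2 - y^2], and
    [y^2 < 1]. *)
Lemma unit_disk_Re_sqr (z : C) : unit_disk z -> 0 < Re (1 + z * z)%C.
Proof.
  destruct z as [x y]; unfold unit_disk, Cmod; simpl fst; simpl snd; simpl Re.
  intros H; rewrite <- sqrt_1 in H; apply sqrt_lt_0_alt in H; nra.
Qed.

(** Does the same for the outer logarithm: the root has real part [p > 0], and [p^2 > x^2] gives
    [p > |x|]. *)
Lemma Re_add_Csqrt_pos (z : C) :
  unit_disk z -> 0 < Re (z + Csqrt (1 + z * z))%C.
Proof.
  intros Hz; apply unit_disk_Re_sqr in Hz.
  pose proof (Csqrt_sqr _ Hz) as Hs; pose proof (Re_Csqrt_pos _ Hz) as Hp.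
  destruct (Csqrt (1 + z * z)%C) as [p q]; destruct z as [x y].
  injection Hs; simpl in *; intros H1 H2.
  (* [x^2 - y^2 + 1 = p^2 - q^2] and [x y = p q] force [p^2 > x^2]. *)
  assert (Hx : x ^ 2 < p ^ 2).
  (* Otherwise the first equation gives [q^2 < y^2], so [p^2 q^2 < p^2 y^2 <= x^2 y^2], against
     [p q = x y]. *)
  { destruct (Rlt_le_dec (x ^ 2) (p ^ 2)) as [h | h]; [exact h | exfalso].
    assert (q ^ 2 < y ^ 2) by nra.
    assert (H3 : (p * q) ^ 2 = (x * y) ^ 2) by (f_equal; lra).
    assert (p ^ 2 * q ^ 2 < x ^ 2 * y ^ 2) by nra.
    nra. }
  nra.
Qed.

Lemma analytic_Carcsinh : analytic_on_disk Carcsinh.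
Proof.
  intros z Hz.
  pose proof (unit_disk_Re_sqr z Hz) as H1.
  destruct (ex_derive_Csqrt _ H1) as [l Hl].
  destruct (ex_derive_Clog _ (Re_add_Csqrt_pos z Hz)) as [m Hm].
  eexists.
  apply (is_C_derive_comp Clog (fun t => t + Csqrt (1 + t * t))%C z m); [exact Hm | ].
  apply (@is_derive_plus C_AbsRing C_NormedModule (fun t => t)
    (fun t => Csqrt (1 + t * t))%C).
  - apply is_derive_C_AbsRing, @is_derive_id.
  - apply (is_C_derive_comp Csqrt (fun t => 1 + t * t)%C z l); [exact Hl | ].
    apply (@is_derive_plus C_AbsRing C_NormedModule (fun _ => RtoC 1) (fun t => t * t)%C).
    + apply @is_derive_const.
    + apply is_derive_C_AbsRing, (is_derive_mult (K := C_AbsRing) (fun t => t) (fun t => t)).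
      * apply is_derive_id.
      * apply is_derive_id.
      * apply Cmult_comm.
Qed.

Lemma Ccosh_sqr (z : C) : (Ccosh z * Ccosh z = 1 + Csinh z * Csinh z)%C.
Proof.
  destruct z as [x y]; unfold Ccosh, Csinh, Cmult, Cplus; simpl.
  assert (Hh : cosh x * cosh x = 1 + sinh x * sinh x).
  { unfold cosh, sinh; pose proof (exp_plus x (- x)) as He.
    rewrite Rplus_opp_r, exp_0 in He; nra. }
  pose proof (sin2_cos2 y) as Ht; unfold Rsqr in Ht.
  f_equal; [ | ring].
  transitivity (cosh x * cosh x * (cos y * cos y) - sinh x * sinh x * (sin y * sin y));
    [ring | ].
  transitivity (1 + (sinh x * sinh x * (cos y * cos y) - cosh x * cosh x * (sin y * sin y)));
    [ | ring].
  rewrite Hh.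
  replace (cos y * cos y) with (1 - sin y * sin y) by lra; ring.
Qed.

(** In the strip [Ccosh z] has positive real part, so it is the principal root of
    [1 + Csinh z * Csinh z]. Then [Csinh z + Ccosh z = Cexp z], which [Clog] inverts. *)
Lemma Carcsinh_Csinh (z : C) :
  - (PI / 2) < Im z < PI / 2 -> unit_disk (Csinh z) -> Carcsinh (Csinh z) = z.
Proof.
  intros Hz Hd; unfold Carcsinh.
  rewrite (Csqrt_unique _ (Ccosh z)).
  - replace (Csinh z + Ccosh z)%C with (Cexp z); [now apply Clog_Cexp | ].
    unfold Csinh, Ccosh, Cexp, Cplus, sinh, cosh; simpl; f_equal; field.
  - now apply unit_disk_Re_sqr.
  - simpl; apply Rmult_lt_0_compat; [ | apply cos_gt_0; lra].
    unfold cosh; pose proof (exp_pos (Re z)); pose proof (exp_pos (- Re z)); lra.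
  - apply Ccosh_sqr.
Qed.

(** * Real estimates for [sinh] and the modulus of [Csinh] *)

Lemma sinh_nonneg (x : R) : 0 <= x -> 0 <= sinh x.
Proof.
  intros [Hx | <-]; [ | rewrite sinh_0; lra].
  apply Rlt_le; rewrite <- sinh_0; now apply sinh_lt.
Qed.

Lemma cosh_le (x y : R) : 0 <= x <= y -> cosh x <= cosh y.
Proof.
  intros [Hx Hxy].
  destruct (MVT_gen cosh x y sinh) as [t [[Ht _] He]].
  - intros t _; apply is_derive_Reals, derivable_pt_lim_cosh.
  - intros t _; apply derivable_continuous, derivable_cosh.
  - rewrite Rmin_left in Ht by exact Hxy.
    pose proof (sinh_nonneg t ltac:(lra)); nra.
Qed.

Lemma cosh_ge_1 (x : R) : 1 <= cosh x.
Proof.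
  unfold cosh; pose proof (exp_plus x (- x)) as He.
  rewrite Rplus_opp_r, exp_0 in He.
  pose proof (exp_pos x); pose proof (exp_pos (- x)).
  pose proof (pow2_ge_0 (exp x - exp (- x))).
  destruct (Rle_lt_dec 2 (exp x + exp (- x))); [lra | nra].
Qed.

Lemma sinh_ge_id (x : R) : 0 <= x -> x <= sinh x.
Proof.
  intros Hx.
  destruct (MVT_gen sinh 0 x cosh) as [t [_ He]].
  - intros t _; apply is_derive_Reals, derivable_pt_lim_sinh.
  - intros t _; apply derivable_continuous, derivable_sinh.
  - rewrite sinh_0 in He; pose proof (cosh_ge_1 t); nra.
Qed.

(** Convexity with [sinh 0 = 0]: the mean slope on [[0, t s]] is at most that on [[t s, s]], since
    [cosh] increases there. *)
Lemma sinh_scal_le (s t : R) : 0 <= s -> 0 <= t <= 1 -> sinh (t * s) <= t * sinh s.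
Proof.
  intros Hs Ht.
  assert (H1 : 0 <= t * s <= s) by nra.
  destruct (MVT_gen sinh 0 (t * s) cosh) as [a [Ha Hea]].
  { intros r _; apply is_derive_Reals, derivable_pt_lim_sinh. }
  { intros r _; apply derivable_continuous, derivable_sinh. }
  destruct (MVT_gen sinh (t * s) s cosh) as [b [Hb Heb]].
  { intros r _; apply is_derive_Reals, derivable_pt_lim_sinh. }
  { intros r _; apply derivable_continuous, derivable_sinh. }
  rewrite Rmin_left, Rmax_right in Ha by lra.
  rewrite Rmin_left, Rmax_right in Hb by lra.
  rewrite sinh_0 in Hea.
  pose proof (cosh_le a b ltac:(lra)) as Hab.
  assert (0 <= s * t * (1 - t)) by (repeat apply Rmult_le_pos; lra).
  (* By the two mean-value identities this reads [(1 - t) sinh (t s) <= t (sinh s - sinh (t s))]. *)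
  assert (s * t * (1 - t) * cosh a <= s * t * (1 - t) * cosh b)
    by (apply Rmult_le_compat_l; assumption).
  nra.
Qed.

(** The derivative [2 (sinh t cosh t - t)] is nonnegative because [sinh t >= t] and
    [cosh t >= 1]. *)
Lemma sinh_sqr_sub_sqr_le (x y : R) :
  0 <= x <= y -> sinh x ^ 2 - x ^ 2 <= sinh y ^ 2 - y ^ 2.
Proof.
  intros [Hx Hxy].
  destruct (MVT_gen (fun t => sinh t ^ 2 - t ^ 2) x y
              (fun t => 2 * (sinh t * cosh t - t))) as [t [[Ht _] He]].
  - intros t _; auto_derive; [exact I | ring].
  - intros t _; apply continuity_pt_filterlim.
    apply (@ex_derive_continuous R_AbsRing R_NormedModule
             (fun t => sinh t ^ 2 - t ^ 2)).
    auto_derive; exact I.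
  - rewrite Rmin_left in Ht by exact Hxy.
    pose proof (sinh_ge_id t ltac:(lra)); pose proof (cosh_ge_1 t).
    assert (0 <= sinh t * cosh t - t) by nra.
    nra.
Qed.

Lemma sin_sqr_le (x : R) : sin x ^ 2 <= x ^ 2.
Proof.
  destruct (MVT_gen sin 0 x cos) as [t [_ He]].
  - intros t _; apply is_derive_Reals, derivable_pt_lim_sin.
  - intros t _; apply continuity_sin.
  - rewrite sin_0, !Rminus_0_r in He; rewrite He.
    pose proof (COS_bound t).
    assert (0 <= x ^ 2 * (1 - cos t ^ 2)) by (apply Rmult_le_pos; nra).
    nra.
Qed.

(** With [z = x + i y], the squared modulus is [sinh^2 x + sin^2 y <= (sinh^2 x - x^2) + |z|^2], and
    [sinh^2 t - t^2] increases from [|x|] to [|z|]. *)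
Lemma Cmod_Csinh_le (z : C) : Cmod (Csinh z) <= sinh (Cmod z).
Proof.
  pose proof (sinh_nonneg _ (Cmod_ge_0 z)) as Hn.
  rewrite <- (sqrt_pow2 (sinh (Cmod z))) by exact Hn.
  unfold Cmod at 1; apply sqrt_le_1_alt.
  assert (Hm : Cmod z ^ 2 = Re z ^ 2 + Im z ^ 2).
  { unfold Cmod; apply pow2_sqrt; nra. }
  assert (Hc : cosh (Re z) ^ 2 = 1 + sinh (Re z) ^ 2).
  { unfold cosh, sinh; pose proof (exp_plus (Re z) (- Re z)) as He.
    rewrite Rplus_opp_r, exp_0 in He; nra. }
  assert (Hsr : sinh (Rabs (Re z)) ^ 2 = sinh (Re z) ^ 2).
  { unfold Rabs; destruct (Rcase_abs (Re z)); [ | reflexivity].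
    unfold sinh; rewrite Ropp_involutive; field. }
  pose proof (sinh_sqr_sub_sqr_le (Rabs (Re z)) (Cmod z)
    (conj (Rabs_pos _) (re_le_Cmod z))) as Hs.
  rewrite pow2_abs, Hsr in Hs.
  pose proof (sin_sqr_le (Im z)) as Hi.
  pose proof (sin2_cos2 (Im z)) as Ht; unfold Rsqr in Ht.
  unfold Csinh; simpl fst; simpl snd.
  rewrite !Rpow_mult_distr, Hc.
  replace (cos (Im z) ^ 2) with (1 - sin (Im z) ^ 2) by (simpl; lra).
  nra.
Qed.

(** * The Janowski bound and the inclusion of the classes *)

(* On [|w| <= 1] the function [t / (1 - |d| t)] is convex in [t = |w|], so the
   bound by [s t] follows from the one at [t = 1]. *)
Lemma Cmod_Janowski_sub_1_le (c d s : R) (w : C) :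
  Rabs d < 1 -> d < c -> c - d <= (1 - Rabs d) * s -> Cmod w <= 1 ->
  Cmod ((1 + RtoC c * w) / (1 + RtoC d * w) - 1)%C <= Cmod w * s.
Proof.
  intros Hd Hdc Hs Hw.
  pose proof (Rabs_pos d); pose proof (Cmod_ge_0 w).
  assert (Hden : 1 - Rabs d * Cmod w <= Cmod (1 + RtoC d * w)%C).
  { pose proof (Cmod_triangle (1 + RtoC d * w) (- (RtoC d * w)))%C as Ht.
    replace (1 + RtoC d * w + - (RtoC d * w))%C with (RtoC 1) in Ht by ring.
    rewrite Cmod_opp, Cmod_mult, !Cmod_R, Rabs_R1 in Ht; lra. }
  assert (Hpos : 0 < 1 - Rabs d * Cmod w) by nra.
  assert (Hne : (1 + RtoC d * w)%C <> 0).
  { intros E; rewrite E, Cmod_0 in Hden; lra. }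
  replace ((1 + RtoC c * w) / (1 + RtoC d * w) - 1)%C
    with (RtoC (c - d) * w / (1 + RtoC d * w))%C
    by (rewrite RtoC_minus; field; exact Hne).
  rewrite Cmod_div, Cmod_mult, Cmod_R, Rabs_pos_eq by (exact Hne || lra).
  assert (Hs0 : 0 < s) by nra.
  apply Rle_div_l; [lra | ].
  (* This is the gap between [s (1 - |d| |w|)] and [s (1 - |d|)], the latter being at least
     [c - d]. *)
  assert (0 <= s * Rabs d * (1 - Cmod w))
    by (repeat apply Rmult_le_pos; lra).
  assert (c - d <= s * (1 - Rabs d * Cmod w)) by nra.
  assert (c - d <= s * Cmod (1 + RtoC d * w)%C) by nra.
  nra.
Qed.

Theorem theorem3p2 (c d : R) (hd : -1 < d) (hdc : d < c) (hc : c <= 1)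
  (h : ((1 - arcsinh 1) * (1 - d ^ 2) < 1 - c * d <= 1 - d ^ 2 /\
        c - d <= (1 - d) * arcsinh 1) \/
       (1 - d ^ 2 <= 1 - c * d < (1 + arcsinh 1) * (1 - d ^ 2) /\
        c - d <= (1 + d) * arcsinh 1)) :
  forall f : C -> C, S_star_Janowski c d f -> S_star_rho f.
Proof.
  intros f [[HA _] [Hnz [Hq [_ [w [_ [_ [Hw Heq]]]]]]]].
  assert (Hd1 : Rabs d < 1) by (apply Rabs_def1; lra).
  assert (Hs : c - d <= (1 - Rabs d) * arcsinh 1).
  (* [1 - c d <= 1 - d^2] says [d (c - d) >= 0], which forces [d >= 0]; the reverse inequality
     forces [d <= 0]. *)
  { destruct h as [[[_ h1] h2] | [[h1 _] h2]].
    - rewrite Rabs_pos_eq; [exact h2 | nra].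
    - rewrite Rabs_left1; [lra | nra]. }
  assert (Hs0 : 0 < arcsinh 1) by nra.
  assert (HsPI : arcsinh 1 < PI / 2).
  (* [arcsinh 1 <= sinh (arcsinh 1) = 1 < PI / 2]. *)
  { pose proof (sinh_ge_id _ (Rlt_le _ _ Hs0)) as H; rewrite sinh_arcsinh in H.
    pose proof PI2_1; lra. }
  set (zeta := fun z => (star_quotient f z - 1)%C).
  assert (Hzeta : forall z, unit_disk z -> Cmod (zeta z) <= Cmod z * arcsinh 1).
  { intros z Hz; unfold zeta; rewrite (Heq z Hz).
    pose proof (Hw z Hz); unfold unit_disk in Hz.
    apply Rle_trans with (Cmod (w z) * arcsinh 1).
    - apply Cmod_Janowski_sub_1_le; lra.
    - apply Rmult_le_compat_r; lra. }
  assert (Homega : forall z, unit_disk z -> Cmod (Csinh (zeta z)) <= Cmod z).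
  { intros z Hz; pose proof (Cmod_ge_0 z); unfold unit_disk in Hz.
    apply Rle_trans with (1 := Cmod_Csinh_le _).
    apply Rle_trans with (sinh (Cmod z * arcsinh 1)).
    - destruct (Hzeta z Hz) as [Hlt | ->]; [ | lra].
      now apply Rlt_le, sinh_lt.
    - rewrite <- (Rmult_1_r (Cmod z)) at 2; rewrite <- (sinh_arcsinh 1) at 2.
      apply sinh_scal_le; lra. }
  split; [exact HA | split; [exact Hnz | ]].
  split; [exact Hq | split].
  { intros z Hz; destruct (analytic_Carcsinh z Hz) as [l Hl].
    eexists; apply (@is_derive_plus C_AbsRing C_NormedModule (fun _ => RtoC 1)).
    - apply @is_derive_const.
    - exact Hl. }
  exists (fun z => Csinh (zeta z)); repeat split.
  - intros z Hz; destruct (Hq z Hz) as [l Hl].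
    eexists; apply (is_C_derive_comp Csinh zeta z (Ccosh (zeta z))).
    + apply is_derive_Csinh.
    + apply (@is_derive_minus C_AbsRing C_NormedModule (star_quotient f) (fun _ => RtoC 1)).
      * exact Hl.
      * apply @is_derive_const.
  (* The value 1 filled in at the origin makes [zeta] vanish there. *)
  - unfold zeta, star_quotient; destruct (Ceq_dec 0 0) as [_ | n]; [ | now elim n].
    replace (1 - 1)%C with (RtoC 0) by ring.
    unfold Csinh; simpl; rewrite sinh_0, sin_0; unfold RtoC; f_equal; ring.
  - exact Homega.
  - intros z Hz; pose proof (Hzeta z Hz) as Hzz; pose proof (Homega z Hz).
    unfold unit_disk in Hz; pose proof (Cmod_ge_0 z).
    rewrite Carcsinh_Csinh.
    + unfold zeta; ring.
    (* [|Im (zeta z)| <= |zeta z| <= |z| arcsinh 1 < PI / 2] puts [zeta z] in the strip where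
       [Carcsinh] inverts [Csinh]. *)
    + pose proof (Rmax_Cmod (zeta z)) as Hm.
      pose proof (Rmax_r (Rabs (fst (zeta z))) (Rabs (snd (zeta z)))).
      assert (Hi : Rabs (Im (zeta z)) < PI / 2) by (unfold Im; nra).
      apply Rabs_def2 in Hi; lra.
    + unfold unit_disk; lra.
Qed.
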